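(* There is a family $\mathcal{F}$ of binary relations which contains an antichain (with respect to the Tukey order $\leq$) of cardinality $2^{\aleph_1}$, is downwards directed in $\leq$, and is such that for all $R$ in $\mathcal{F}$, $R \not\leq \aleph_0\cdot\omega_1$ and $[\omega_1]^{<\aleph_0}\not\leq R$.
   Context: The ambient theory is ZFC. A binary relation $R$ comes with a domain $\operatorname{dom}(R)$ and a range (codomain) $\operatorname{ran}(R)$, so $R\subseteq \operatorname{dom}(R)\times\operatorname{ran}(R)$. Tukey order: $R\leq S$ iff there are functions $f:\operatorname{dom}(R)\to\operatorname{dom}(S)$ and $g:\operatorname{ran}(S)\to\operatorname{ran}(R)$ such that for all $x\in\operatorname{dom}(R)$ and $y\in\operatorname{ran}(S)$, $f(x)\ S\ y$ implies $x\ R\ g(y)$. Here $\omega_1$ as a relation is the well order $\leq$ on $\omega_1$ (domain and range $\omega_1$), and $[\omega_1]^{<\aleph_0}$ is the set of finite subsets of $\omega_1$ ordered by inclusion $\subseteq$. The relation $\aleph_0\cdot\omega_1$ is the direct sum (disjoint union) of $\aleph_0$ copies of $\omega_1$: its domain and range are $\omega\times\omega_1$ and $(m,\alpha)$ is related to $(n,\beta)$ iff $m=n$ and $\alpha\leq\beta$. An antichain is a collection of relations that are pairwise incomparable under $\leq$. $\mathcal{F}$ is downwards directed if for all $R,S\in\mathcal{F}$ there is $T\in\mathcal{F}$ with $T\leq R$ and $T\leq S$. *)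

(* Defs.v *)
From mathcomp Require Import all_boot all_order all_classical.
From mathcomp Require Import wochoice.

Set Implicit Arguments.
Unset Strict Implicit.
Unset Printing Implicit Defensive.

Local Open Scope classical_set_scope.

Record binrel := BinRel {
  dom : Type;
  ran : Type;
  rel_of :> dom -> ran -> Prop }.

Definition tukey_le (R S : binrel) : Prop :=
  exists (f : dom R -> dom S) (g : ran S -> ran R),
    forall (x : dom R) (y : ran S), S (f x) y -> R x (g y).

(* Families of relations are plain predicates, not [set binrel]: [set] is
   universe-monomorphic, so [set binrel] would forbid relations whose domain or
   range is built with [set], such as [omega1_rel] below. *)
Definition tukey_antichain (A : binrel -> Prop) : Prop :=
  forall R S, A R -> A S -> R <> S -> ~ tukey_le R S /\ ~ tukey_le S R.

Definition tukey_down_directed (F : binrel -> Prop) : Prop :=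
  forall R S, F R -> F S -> exists T, [/\ F T, tukey_le T R & tukey_le T S].

(* For the same reason this is not [A #= [set: T]]. *)
Definition has_card_of (A : binrel -> Prop) (T : Type) : Prop :=
  exists e : T -> binrel,
    injective e /\ (forall R, A R <-> exists t, e t = R).

(* The direct sum of I-many copies of R. *)
Definition copies (I : Type) (R : binrel) : binrel :=
  @BinRel (I * dom R) (I * ran R) (fun p q => p.1 = q.1 /\ R p.2 q.2).

(* The elements of a well-ordered uncountable type that have only countably
   many predecessors form an initial segment of order type omega_1, whatever
   the uncountable type and the well-order: see the lemmas below. *)
Definition pow_nat_le : rel (set nat) := sval (well_ordering_principle (set nat)).

Definition omega1 : Type :=
  {x : set nat | countable [set y | pow_nat_le y x]}.

Definition omega1_le (x y : omega1) : bool := pow_nat_le (sval x) (sval y).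

Definition omega1_rel : binrel := @BinRel omega1 omega1 omega1_le.

Definition fin_omega1 : Type := {A : set omega1 | finite_set A}.

Definition fin_omega1_rel : binrel :=
  @BinRel fin_omega1 fin_omega1 (fun A B => sval A `<=` sval B).

Lemma pow_nat_le_wo : well_order pow_nat_le.
Proof. exact: (svalP (well_ordering_principle (set nat))). Qed.

Lemma pow_nat_le_total_order : total_order pow_nat_le.
Proof.
have wo : wo_chain pow_nat_le predT.
  by move=> A _; exact: pow_nat_le_wo.
have refl := wo_chain_reflexive wo.
have tot := wo_chainW wo.
have anti := wo_chain_antisymmetric wo.
split; [split; [split|]|]; first by move=> x; exact: refl.
- move=> y x z xy yz.
  have [|m [[mA lb] _]] := @pow_nat_le_wo (pred3 x y z).
    by exists x; rewrite !inE eqxx.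
  have mx : pow_nat_le m x by apply: lb; rewrite !inE eqxx.
  have my : pow_nat_le m y by apply: lb; rewrite !inE eqxx !orbT.
  have mz : pow_nat_le m z by apply: lb; rewrite !inE eqxx !orbT.
  move: mA; rewrite !inE => /or3P[] /eqP Em; subst m => //.
  + have exy : x = y by apply: anti => //; rewrite xy mx.
    by rewrite exy.
  + have ezy : z = y by apply: anti => //; rewrite my yz.
    by rewrite ezy.
- by move=> x y; exact: anti.
- by move=> x y; exact: tot.
Qed.

Lemma omega1_val_inj : injective (sval : omega1 -> set nat).
Proof. by move=> x y; apply: eq_sig_hprop => ? ? ?; exact: Prop_irrelevance. Qed.

Lemma omega1_le_wo : well_order omega1_le.
Proof.
have [[[refl trans] anti] tot] := pow_nat_le_total_order.
move=> A [a aA].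
pose B : {pred set nat} :=
  fun x => `[< exists2 b : omega1, b \in A & sval b = x >].
have [|m [[mB lb] _]] := @pow_nat_le_wo B.
  by exists (sval a); apply/asboolP; exists a.
have [b bA bm] := asboolP _ mB.
exists b; split.
  split=> // c cA; rewrite /omega1_le bm; apply: lb.
  by apply/asboolP; exists c.
move=> c [cA lbc]; apply: omega1_val_inj.
apply: anti; apply/andP; split; last exact: lbc.
by rewrite bm; apply: lb; apply/asboolP; exists c.
Qed.

Lemma omega1_countable_segment (a : omega1) :
  countable [set b | omega1_le b a].
Proof.
have /countable_injP[f finj] := svalP a.
apply/countable_injP; exists (f \o sval) => x y.
by rewrite !inE => xa ya /finj xy; apply: omega1_val_inj; apply: xy; rewrite inE.
Qed.

Lemma pow_nat_uncountable : ~ countable [set: set nat].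
Proof.
move=> /countable_injP[f finj].
pose D : set nat := [set n | exists2 X : set nat, f X = n & ~ X n].
have DD : ~ D (f D).
  move=> D1; case: (D1) => X XD; apply.
  by have -> : X = D by apply: finj => //; rewrite inE.
by apply: (DD); exists D.
Qed.

Lemma omega1_uncountable : ~ countable [set: omega1].
Proof.
move=> /countable_injP[f finj].
pose S : set (set nat) := [set x | countable [set y | pow_nat_le y x]].
have Scount : countable S.
  pose g (x : set nat) :=
    if pselect (S x) is left Sx then f (exist _ x Sx) else 0.
  apply/countable_injP; exists g => x y; rewrite !inE /g => Sx Sy.
  case: pselect => // {}Sx; case: pselect => // {}Sy.
  by move=> /finj E; have /(congr1 sval) := E (mem_set I) (mem_set I).
have [[[refl _] _] tot] := pow_nat_le_total_order.
pose B : {pred set nat} := fun x => `[< ~ S x >].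
have [[x nSx]|allS] := pselect (exists x, ~ S x); last first.
  apply: pow_nat_uncountable; apply: sub_countable Scount.
  by apply: subset_card_le => x _; apply: contrapT => nSx; apply: allS; exists x.
have [|m [[mB lb] _]] := @pow_nat_le_wo B; first by exists x; apply/asboolP.
have nSm := asboolP _ mB; apply: nSm.
have [[_ anti] _] := pow_nat_le_total_order.
apply: (@sub_countable _ _ _ (S `|` [set m])); last first.
  rewrite -bigcup2E; apply: bigcup_countable => // -[|[|n]] _ //=.
apply: subset_card_le => y /= ym.
have [Sy|nSy] := pselect (S y); [by left|right].
by apply: anti; rewrite ym lb //; apply/asboolP.
Qed.

(* Main.v *)
From HB Require Import structures.
Require Import Defs.
From mathcomp Require Import all_boot all_order all_classical.

(** To a set [S] of countable ordinals attach the relation [limits_in_rel S]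
    between points of omega_1 and those sets [A] all of whose limit points lie
    in [S], a point being related to [A] when it belongs to [A]. A larger [S]
    has more sets [A], hence a smaller relation (identity and inclusion).

    The Tukey order sees [S] up to nonstationary sets: if [T `\` S] is
    stationary, then [limits_in_rel S] is not below [limits_in_rel T]
    ([limits_in_not_le]). A reduction of one to the other is a map [f] on
    omega_1, countable-to-one because the fibres lie in bounded sets. Some [d]
    in [T `\` S] is then closed enough to carry a sequence converging to [d]
    whose image under [f] converges to [d] too. The image has [d] as its only
    limit point and [d] is in [T], so the image is in the range for [T]; its
    partner in the range for [S] contains the sequence itself, which makes [d]
    a point of [S].

    The finite sets are exactly the sets without limit points, so the finite
    subsets of omega_1 under inclusion behave as [limits_in_rel set0], and the
    same lemma keeps them from being below [limits_in_rel S] for stationary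
    [S] ([fin_omega1_not_le]). On the other side [limits_in_rel Z] is not below
    countably many copies of omega_1 when the complement of [Z] is stationary
    ([limits_in_not_le_copies]): one copy would receive uncountably many
    points, the initial parts of this uncountable set would lie in members of
    the range for [Z], and so its limit points, which form a club, would all be
    in [Z].

    Now fix a stationary [Z] with stationary complement. The family consists
    of the relations for the stationary subsets of [Z]. It has a least element,
    the relation for [Z] itself, so it is directed downwards, and nothing in it
    is below the copies of omega_1 since its least element is not. For the
    antichain, Ulam's matrix gives uncountably many disjoint stationary sets;
    choosing one from each of omega_1 disjoint pairs among them gives
    stationary subsets of [Z], one for each subset of omega_1, any two with
    stationary differences ([stationary_family]). *)

Set Implicit Arguments.
Unset Strict Implicit.
Unset Printing Implicit Defensive.

Import Order.TTheory.
Local Open Scope order_scope.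
Local Open Scope classical_set_scope.

(** * The well-order omega_1 *)

Lemma omega1_le_refl : reflexive omega1_le.
Proof. by have [[[+ _] _] _] := pow_nat_le_total_order => + x; apply. Qed.

Lemma omega1_le_anti : antisymmetric omega1_le.
Proof.
have [[_ anti] _] := pow_nat_le_total_order.
by move=> x y /anti; exact: omega1_val_inj.
Qed.

Lemma omega1_le_trans : transitive omega1_le.
Proof. by have [[[_ +] _] _] := pow_nat_le_total_order => + y x z; apply. Qed.

Lemma omega1_le_total : total omega1_le.
Proof. by have [_ +] := pow_nat_le_total_order => + x y; apply. Qed.

HB.instance Definition _ := gen_eqMixin omega1.
HB.instance Definition _ := gen_choiceMixin omega1.
HB.instance Definition _ := @Order.Le_isPOrder.Build Order.default_display omega1
  omega1_le omega1_le_refl omega1_le_anti omega1_le_trans.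
HB.instance Definition _ :=
  Order.POrder_isTotal.Build Order.default_display omega1 omega1_le_total.

Lemma omega1_least (P : set omega1) a : P a ->
  exists2 m, P m & forall x, P x -> m <= x.
Proof.
move=> Pa; have [|m [[mP lb] _]] := @omega1_le_wo (fun x => `[< P x >]).
  by exists a; apply/asboolP.
by exists m; [exact/asboolP|move=> x Px; apply: lb; apply/asboolP].
Qed.

Lemma omega1_lt_wf : well_founded (fun x y : omega1 => x < y).
Proof.
move=> a; apply: contrapT => /(omega1_least (P := fun x => ~ Acc _ x))[m + lb].
apply; constructor => y ym; apply: contrapT => /lb.
by rewrite leNgt ym.
Qed.

(** omega_1 is regular: otherwise it would be a countable union of its
    countable initial segments. *)
Lemma countable_ub (B : set omega1) : countable B ->
  exists b, forall x, B x -> x < b.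
Proof.
move=> cB; apply: contrapT => nb; apply: omega1_uncountable.
apply: (@sub_countable _ _ _ (\bigcup_(b in B) [set x | omega1_le x b])).
  apply: subset_card_le => x _; apply: contrapT => nx; apply: nb; exists x.
  move=> b Bb; rewrite ltNge; apply/negP => xb; apply: nx; by exists b.
by apply: bigcup_countable => // b _; exact: omega1_countable_segment.
Qed.

Lemma omega1_inhabited : exists a : omega1, True.
Proof. by have [b _] := countable_ub (countable0 omega1); exists b. Qed.

Lemma uncountable_fiber (f : omega1 -> nat) :
  exists n, ~ countable [set x | f x = n].
Proof.
apply: contrapT => nf; apply: omega1_uncountable.
apply: (@sub_countable _ _ _ (\bigcup_n [set x | f x = n])).
  by apply: subset_card_le => x _; exists (f x).
by apply: bigcup_countable => // n _; apply: contrapT => cn; apply: nf; exists n.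
Qed.

Lemma countable_range (T : Type) (s : nat -> T) : countable (range s).
Proof. exact: sub_countable (card_image_le _ _) (countableP _). Qed.

Lemma seq_ub (s : nat -> omega1) : exists b, forall n, s n < b.
Proof.
have [b sb] := countable_ub (countable_range s).
by exists b => n; apply: sb; exists n.
Qed.

Lemma image_segment_ub (F : omega1 -> omega1) a :
  exists b, forall x, x <= a -> F x < b.
Proof.
have [|b Fb] := @countable_ub (F @` [set x | omega1_le x a]).
  exact: sub_countable (card_image_le _ _) (omega1_countable_segment a).
by exists b => x xa; apply: Fb; exists x.
Qed.

Lemma unbounded_above (D : set omega1) : ~ countable D ->
  forall a, exists2 x, D x & a < x.
Proof.
move=> uD a; apply: contrapT => nD; apply: uD.
apply: sub_countable (omega1_countable_segment a).
apply: subset_card_le => x Dx; apply: contrapT => xa; apply: nD; exists x => //.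
by rewrite ltNge; apply/negP.
Qed.

(** * Stationary sets *)

Definition closed_under (F : omega1 -> omega1) (d : omega1) : Prop :=
  forall x, x < d -> F x < d.

(** The points above [a] that are closed under [F] form a club, and each club
    contains such a set: take for [F x] a point of the club above [x]. So this
    is stationarity in the usual sense. *)
Definition stationary (S : set omega1) : Prop :=
  forall F a, exists d, [/\ S d, a < d & closed_under F d].

Lemma stationary_sub (S T : set omega1) :
  S `<=` T -> stationary S -> stationary T.
Proof. by move=> ST stS F a; have [d [/ST]] := stS F a; exists d. Qed.

(** The point [d] is the supremum of [a], [G a], [G (G a)], ... where [G x]
    exceeds [F y] for all [y <= x]. *)
Lemma stationaryT : stationary [set: omega1].
Proof.
move=> F a; have /choice[G FG] := image_segment_ub F.
pose s n := iter n G a.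
have [b sb] := seq_ub s.
have [d sd dmin] := omega1_least (P := fun d => forall n, s n < d) sb.
exists d; split => //; first exact: (sd 0%N).
move=> x xd; have [n xn] : exists n, x <= s n.
  apply: contrapT => nx; move: xd; rewrite ltNge dmin// => n.
  by rewrite ltNge; apply/negP => xn; apply: nx; exists n.
exact: lt_trans (FG _ _ xn) (sd n.+1).
Qed.

Lemma stationary_gt a : stationary [set x | a < x].
Proof.
move=> F b; have [d [_ mxd cl]] := stationaryT F (Order.max a b).
by exists d; split; rewrite //=; apply: le_lt_trans mxd; rewrite le_max lexx ?orbT.
Qed.

(** Countably many functions are dominated by one, so countably many clubs
    have a common club inside: nonstationary sets form a sigma-ideal. *)
Lemma stationary_bigcup (S : nat -> set omega1) :
  stationary (\bigcup_n S n) -> exists n, stationary (S n).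
Proof.
move=> stS; apply: contrapT => nst.
have /choice[F] n : exists F : omega1 -> omega1, exists a,
    forall d, S n d -> a < d -> ~ closed_under F d.
  apply: contrapT => nF; apply: nst; exists n => F a.
  apply: contrapT => nd; apply: nF; exists F, a => d Sd ad cl.
  by apply: nd; exists d.
move=> /choice[a Fa]; have [b ab] := seq_ub a.
have /choice[G FG] x := seq_ub (fun n => F n x).
have [d [[n _ Sd] bd cl]] := stS G b.
apply: (Fa n d Sd); first exact: lt_trans (ab n) bd.
by move=> x xd; apply: lt_trans (FG x n) (cl x xd).
Qed.

(** * Disjoint stationary sets *)

(** Ulam's matrix: with injections [e b] of the countable segments below [b]
    into nat, each row [[set b | a <= b /\ e b a = n]], n in nat, covers a
    tail of omega_1 and so has a stationary entry, while entries of the same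
    column n are disjoint. Uncountably many rows have their stationary entry
    in the same column. *)
Lemma ulam : exists (U : omega1 -> set omega1) (W : set omega1),
  [/\ ~ countable W, forall a, W a -> stationary (U a)
    & forall a b x, U a x -> U b x -> a = b].
Proof.
have /choice[e einj] b : exists e : omega1 -> nat,
    forall x y, x <= b -> y <= b -> e x = e y -> x = y.
  have /countable_injP[e einj] := omega1_countable_segment b.
  by exists e => x y xb yb; apply: einj; rewrite inE.
pose U n a := [set b | a <= b /\ e b a = n].
have /choice[N stU] a : exists n, stationary (U n a).
  apply: stationary_bigcup; apply: stationary_sub (stationary_gt a).
  by move=> x /= ax; exists (e x a); rewrite //; split=> //; exact: ltW.
have [n un] := uncountable_fiber N.
exists (U n), [set a | N a = n]; split => // [a <-//|a b x [ax ea] [bx eb]].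
by apply: (einj x) => //; rewrite ea.
Qed.

(** Well-founded recursion: at each [a] two new points of [W] are available,
    since only countably many have been used before. *)
Lemma omega1_bool_embedding (W : set omega1) : ~ countable W ->
  exists phi : bool -> omega1 -> omega1,
    (forall i a, W (phi i a)) /\
    (forall i j a b, phi i a = phi j b -> i = j /\ a = b).
Proof.
move=> uW.
pose old (a : omega1) (h : forall y, y < a -> omega1 * omega1) : set omega1 :=
  [set x | exists y (ya : y < a), x = (h y ya).1 \/ x = (h y ya).2].
have ext a h : exists p : omega1 * omega1,
    [/\ W p.1, W p.2, p.1 <> p.2, ~ old a h p.1 & ~ old a h p.2].
  have /countable_ub[b ob] : countable (old a h).
    (* The functions [k 0] and [k 1] extend the two components of [h] to all
       of omega_1, so that their images of the segment cover [old a h]. *)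
    pose k i (y : omega1) : omega1 :=
      if pselect (y < a) is left ya then
        if i == 0%N then (h y ya).1 else (h y ya).2
      else a.
    apply: (@sub_countable _ _ _
      (\bigcup_i (k i @` [set y | omega1_le y a]))).
      apply: subset_card_le => x [y [ya xE]].
      have yle : omega1_le y a := ltW ya.
      case: xE => ->; [exists 0%N|exists 1%N] => //; exists y => //;
        rewrite /k; case: pselect => //= ya'; by rewrite (bool_irrelevance ya' ya).
    apply: bigcup_countable => [|i _]; first exact: countableP.
    exact: sub_countable (card_image_le _ _) (omega1_countable_segment a).
  have [x Wx bx] := unbounded_above uW b; have [y Wy xy] := unbounded_above uW x.
  exists (x, y); split => //=.
  - by move=> E; move: xy; rewrite E ltxx.
  - by move=> /ob; rewrite ltNge (ltW bx).
  - by move=> /ob; rewrite ltNge (ltW (lt_trans bx xy)).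
pose step a h := projT1 (cid (ext a h)).
have stepP a h : [/\ W (step a h).1, W (step a h).2, (step a h).1 <> (step a h).2,
    ~ old a h (step a h).1 & ~ old a h (step a h).2].
  by rewrite /step; case: cid.
pose psi := Fix omega1_lt_wf (fun _ => (omega1 * omega1)%type) step.
have psiE a : psi a = step a (fun y _ => psi y).
  rewrite /psi Fix_eq // => x h k hk; congr (step x _).
  by apply: functional_extensionality_dep => y;
    apply: functional_extensionality_dep => yx.
pose phi (i : bool) a := if i then (psi a).1 else (psi a).2.
have phi_fresh i j a b : a < b -> phi i a <> phi j b.
  move=> ab E; have [_ _ _ n1 n2] := stepP b (fun y _ => psi y).
  have : old b (fun y _ => psi y) (phi j b).
    by exists a, ab; rewrite -E /phi; case: (i); [left|right].
  by rewrite /phi psiE; case: (j).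
exists phi; split=> [i a|i j a b E].
  by rewrite /phi psiE; have [] := stepP a (fun y _ => psi y); case: i.
have ab : a = b.
  by case: (ltgtP a b) => // /phi_fresh; [move=> /(_ i j)|move=> /(_ j i)] => [|/nesym].
split=> //; move: E; rewrite -ab /phi psiE.
by have [_ _ n12 _ _] := stepP a (fun y _ => psi y); case: i; case: j => // /esym.
Qed.

(** From the disjoint stationary sets [U w], w in W, one is reserved for the
    complement of [Z], and the others supply omega_1 disjoint pairs. A set [A]
    decides which member of the [a]-th pair is put into [S A], according to
    whether [a] is in [A]; encoding [a] by a pair and not by a single stationary
    set makes both differences of [S A] and [S B] stationary, even for
    [A `<=` B]. *)
Lemma stationary_family : exists (Z : set omega1) (S : set omega1 -> set omega1),
  [/\ stationary (~` Z), forall A, S A `<=` Z, forall A, stationary (S A)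
    & forall A B, A <> B -> stationary (S A `\` S B)].
Proof.
have [U [W [uW stU disU]]] := ulam.
have [w0 Ww0] : exists w, W w.
  apply: contrapT => nW; apply: uW; apply: finite_set_countable.
  suff -> : W = set0 by exact: finite_set0.
  by rewrite -subset0 => w Ww; apply: nW; exists w.
have uW0 : ~ countable (W `\ w0).
  move=> c; apply: uW; apply: (@sub_countable _ _ _ (W `\ w0 `|` [set w0])).
    apply: subset_card_le => w Ww.
    by have [->|ne] := pselect (w = w0); [right|left].
  rewrite -bigcup2E; apply: bigcup_countable => // -[|[|n]] _ //=.
have [phi [phiW phi_inj]] := omega1_bool_embedding uW0.
pose S A := \bigcup_a U (phi `[< A a >] a).
have St A a : stationary (U (phi `[< A a >] a)) by apply: stU; case: (phiW `[< A a >] a).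
have SU A a : U (phi `[< A a >] a) `<=` S A by move=> x Ux; exists a.
exists (~` U w0), S; split.
- by rewrite setCK; exact: stU.
- by move=> A x [a _ Ux] U0; have [_] := phiW `[< A a >] a; apply; exact: disU Ux U0.
- by move=> A; apply: stationary_sub (St A w0); exact: SU.
move=> A B AB.
have [a nab] : exists a, `[< A a >] <> `[< B a >].
  apply: contrapT => nab; apply: AB; apply/funext => a.
  by rewrite -(asboolE (A a)) -(asboolE (B a)); congr is_true;
    apply: contrapT => ne; apply: nab; exists a.
apply: stationary_sub (St A a) => x Ux; split; first exact: SU Ux.
move=> [b _ Ub]; have [] := phi_inj _ _ _ _ (disU _ _ _ Ux Ub).
by move=> + ab; rewrite -ab.
Qed.

(** * Limit points *)

Definition limit_point (A : set omega1) (d : omega1) : Prop :=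
  (exists a, a < d) /\ forall a, a < d -> exists x, [/\ A x, a < x & x < d].

Lemma limit_point_lt (A B : set omega1) d :
  (forall x, A x -> x < d -> B x) -> limit_point A d -> limit_point B d.
Proof.
move=> AB [d0 lim]; split=> // a /lim[x [Ax ax xd]].
by exists x; split=> //; exact: AB.
Qed.

Lemma finite_limit_point (A : set omega1) d : finite_set A -> ~ limit_point A d.
Proof.
move=> /finite_seqP[s ->] [[a ad] lim].
suff [b [bd sb]] : exists b, b < d /\ forall x, x \in s -> x < d -> x <= b.
  by have [x [xs bx xd]] := lim b bd; move: bx; rewrite ltNge sb.
elim: s {lim} => [|y s [b [bd sb]]]; first by exists a.
have [yd|dy] := ltP y d.
  exists (Order.max y b); split=> [|x]; first by rewrite gt_max yd.
  by rewrite inE le_max => /predU1P[->|/sb{}sb /sb->]; rewrite ?lexx ?orbT.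
exists b; split=> // x; rewrite inE => /predU1P[->|]; last exact: sb.
by rewrite ltNge dy.
Qed.

(** Limit ordinals below omega_1 have countable cofinality: enumerate the
    points below [d] and let [c n] exceed the first [n] of them. *)
Lemma cofinal_sequence d : (exists a, a < d) ->
  (forall a, a < d -> exists2 b, a < b & b < d) ->
  exists c : nat -> omega1, (forall n, c n < d) /\
    forall a, a < d -> exists M, forall n, (M <= n)%N -> a < c n.
Proof.
move=> [a0 a0d] lim; have /countable_injP[e einj] := omega1_countable_segment d.
have /choice[c cP] n : exists b, b < d /\
    forall a, a < d -> (e a < n)%N -> a < b.
  elim: n => [|n [b [bd IH]]]; first by exists a0.
  have [[a [ad ea]]|na] := pselect (exists a, a < d /\ e a = n); last first.
    exists b; split => // a ad; rewrite ltnS leq_eqVlt => /predU1P[ea|]; last exact: IH.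
    by case: na; exists a.
  have [|b' + bd'] := lim (Order.max a b); first by rewrite gt_max ad.
  rewrite gt_max => /andP[ab' bb']; exists b'; split=> // x xd.
  rewrite ltnS leq_eqVlt => /predU1P[ex|/IH xb]; last exact: lt_trans (xb xd) bb'.
  suff -> : x = a by [].
  by apply: einj; rewrite ?ex ?ea //; apply: mem_set; [exact: (ltW xd)|exact: (ltW ad)].
exists c; split=> [n|a ad]; first by have [] := cP n.
by exists (e a).+1 => n en; have [_] := cP n; apply.
Qed.

(** The limit points of an unbounded set form a club, so they cannot avoid the
    stationary complement of [S]. *)
Lemma costationary_limits_ub (S A : set omega1) : stationary (~` S) ->
  limit_point A `<=` S -> exists b, forall x, A x -> x < b.
Proof.
move=> stS AS; apply: contrapT => nb.
have /choice[F FA] a : exists x, A x /\ a < x.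
  apply: contrapT => na; apply: nb.
  have [b ab] := countable_ub (countable1 a); exists b => x Ax.
  apply: le_lt_trans (ab a erefl); rewrite leNgt; apply/negP => ax.
  by apply: na; exists x.
have [a0 _] := omega1_inhabited.
have [d [nSd ad cl]] := stS F a0.
apply: nSd; apply: AS; split; first by exists a0.
by move=> a /[dup] /cl Fd _; have [AF aF] := FA a; exists (F a).
Qed.

(** * Relations attached to subsets of omega_1 *)

(** The range also contains unbounded sets when [S] contains a club; for
    costationary [S] all its members are bounded, by
    [costationary_limits_ub]. *)
Definition limits_in_rel (S : set omega1) : binrel :=
  @BinRel omega1 {A : set omega1 | limit_point A `<=` S} (fun x A => sval A x).

Lemma limits_in_le (S T : set omega1) : S `<=` T ->
  tukey_le (limits_in_rel T) (limits_in_rel S).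
Proof.
move=> ST.
pose g (A : ran (limits_in_rel S)) : ran (limits_in_rel T) :=
  exist _ (sval A) (subset_trans (svalP A) ST).
by exists id, g.
Qed.

(** A stationary difference is an obstruction because the points closed under
    a bound for [f] and for its fibres form a club: at such a point [d] in
    [T `\` S], both a sequence and its image under [f] converge to [d]. *)
Lemma limits_in_not_le (S T : set omega1) : stationary (T `\` S) ->
  ~ tukey_le (limits_in_rel S) (limits_in_rel T).
Proof.
move=> stTS [/= f [g fg]].
have nS : stationary (~` S) by apply: stationary_sub stTS => x [].
(* The fibre of [f] at [y] lies in the bounded partner of the singleton [y]. *)
have /choice[h hP] y : exists b, forall x, f x = y -> x < b.
  have Ty : limit_point [set y] `<=` T.
    by move=> d /(finite_limit_point (finite_set1 y)).
  have [b yb] := costationary_limits_ub nS (svalP (g (exist _ [set y] Ty))).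
  by exists b => x fx; apply: yb; exact: fg.
have /choice[F FP] c : exists b, [/\ c < b, f c < b & forall x, f x <= c -> x < b].
  have [b hb] := image_segment_ub h c.
  have [b' /(_ _ erefl)] := countable_ub (countable1 (Order.max c (Order.max (f c) b))).
  rewrite !gt_max => /and3P[cb fb bb']; exists b'; split=> // x fx.
  exact: lt_trans (hP _ _ erefl) (lt_trans (hb _ fx) bb').
have [a0 _] := omega1_inhabited.
have [d [[Td nSd] ad cl]] := stTS F a0.
have d_lim a : a < d -> exists2 b, a < b & b < d.
  by move=> ad'; exists (F a); [have [] := FP a|exact: cl].
(* The sequence is [F (c n)] with [c] cofinal in [d]: as [F (c n)] lies above
   all the fibres over points up to [c n], its image lies above [c n]. *)
have [c [cd cM]] := cofinal_sequence (ex_intro _ a0 ad) d_lim.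
pose K := range (fun n => f (F (c n))).
have fF_gt n : c n < f (F (c n)).
  by rewrite ltNge; apply/negP; have [_ _ fle] := FP (c n) => /fle; rewrite ltxx.
have fF_lt n : f (F (c n)) < d.
  by apply: lt_trans (cl _ (cl _ (cd n))); have [] := FP (F (c n)).
have TK : limit_point K `<=` T.
  move=> y Ky; have [yd|dy|->//] := ltgtP y d; last first.
    have [_ /(_ d dy)[_ [[n _ <-] dn _]]] := Ky.
    by move: dn; rewrite ltNge (ltW (fF_lt n)).
  (* Only finitely many terms of the image lie below [y]. *)
  have [M yM] := cM y yd.
  have finM : finite_set ((fun n => f (F (c n))) @` `I_M).
    exact/finite_image/finite_II.
  case: (finite_limit_point finM (d := y)).
  apply: limit_point_lt Ky => _ [n _ <-] fy; exists n => //=.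
  rewrite ltnNge; apply/negP => /yM yc.
  by move: fy; rewrite ltNge (ltW (lt_trans yc (fF_gt n))).
apply: nSd; apply: (svalP (g (exist _ K TK))); split; first by exists a0.
move=> a /cM[n /(_ n (leqnn n)) an]; exists (F (c n)); split.
- by apply: fg; exists n.
- by have [cF _ _] := FP (c n); exact: lt_trans an cF.
- exact: cl.
Qed.

(** Restricted to singletons, a reduction of the finite sets is a reduction of
    [limits_in_rel set0], finite sets having no limit points. *)
Lemma fin_omega1_not_le (S : set omega1) : stationary S ->
  ~ tukey_le fin_omega1_rel (limits_in_rel S).
Proof.
move=> stS [/= f [g fg]]; apply: (@limits_in_not_le set0 S); first by rewrite setD0.
have g_fin A : limit_point (sval (g A)) `<=` set0.
  by move=> d /(finite_limit_point (svalP (g A))).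
exists (fun x => f (exist _ [set x] (finite_set1 x))),
  (fun A => exist (fun B => limit_point B `<=` set0) _ (g_fin A)).
by move=> x A /fg /=; apply.
Qed.

(** Some copy of omega_1 receives an uncountable set [D] of points. The points
    of [D] below a limit point [d] of [D] are countably many, so their images
    are bounded in that copy and a single member of the range contains them
    all; it has [d] as a limit point. But [d] can be taken outside [Z]. *)
Lemma limits_in_not_le_copies (Z : set omega1) : stationary (~` Z) ->
  ~ tukey_le (limits_in_rel Z) (copies nat omega1_rel).
Proof.
move=> stZ [/= f [g fg]].
have [n un] := uncountable_fiber (fun x => (f x).1).
(* Closure under [F] makes [d] a limit of points sent to the [n]-th copy. *)
have /choice[F FP] a : exists x, (f x).1 = n /\ a < x.
  by have [x] := unbounded_above un a; exists x.
have [a0 _] := omega1_inhabited.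
have [d [nZd ad cl]] := stZ F a0; apply: nZd.
have [b fb] := image_segment_ub (fun x => (f x).2) d.
apply: (svalP (g (n, b))); split; first by exists a0.
move=> a /cl Fd; have [Fn aF] := FP a; exists (F a); split=> //.
by apply: fg; split => //=; exact: (ltW (fb _ (ltW Fd))).
Qed.

Lemma tukey_le_trans (R S T : binrel) :
  tukey_le R S -> tukey_le S T -> tukey_le R T.
Proof.
move=> [f [g fg]] [f' [g' fg']]; exists (f' \o f), (g \o g') => x y.
by move=> /fg' /fg.
Qed.

Lemma tukey_le_refl (R : binrel) : tukey_le R R.
Proof. by exists id, id. Qed.

Theorem theorem1p11 :
  exists F : binrel -> Prop,
    [/\ exists A : binrel -> Prop,
          [/\ forall R, A R -> F R, tukey_antichain A
            & has_card_of A (set omega1)],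
        tukey_down_directed F
      & forall R : binrel, F R ->
          ~ tukey_le R (copies nat omega1_rel) /\
          ~ tukey_le fin_omega1_rel R].
Proof.
have [Z [S [stZ SZ stS stSS]]] := stationary_family.
have not_le A B : A <> B -> ~ tukey_le (limits_in_rel (S A)) (limits_in_rel (S B)).
  by move=> /nesym /stSS; exact: limits_in_not_le.
pose F R := exists2 T, limits_in_rel T = R & stationary T /\ T `<=` Z.
have stZ' : stationary Z := stationary_sub (SZ set0) (stS set0).
have ZR R : F R -> tukey_le (limits_in_rel Z) R.
  by move=> [T <- [_ TZ]]; exact: limits_in_le.
exists F; split.
- exists (fun R => exists A, limits_in_rel (S A) = R); split.
  + by move=> _ [A <-]; exists (S A).
  + move=> _ _ [A <-] [B <-] neq; split; apply: not_le => AB; apply: neq; by rewrite AB.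
  + exists (fun A => limits_in_rel (S A)); split=> // A B E.
    apply: contrapT => /not_le; rewrite E; apply; exact: tukey_le_refl.
- move=> R R' FR FR'; exists (limits_in_rel Z); split; [|exact: ZR..].
  by exists Z => //; split=> // x.
- move=> R FR; split.
    move=> /(tukey_le_trans (ZR R FR)); exact: limits_in_not_le_copies.
  by have [T <- [stT _]] := FR; exact: fin_omega1_not_le.
Qed.
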